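(* Let $(X,d)$ be a left K-complete quasi-metric space and let $(Y,\rho)$ be a $T_1$ quasi-metric space having the property that forward convergence implies backward convergence. Then every ff-continuous function from $(X,d)$ to $(Y,\rho)$ is left K-Cauchy regular.
   Context: A quasi-metric on a set $X$ is a function $d:X\times X\to\mathbb{R}$ such that for all $x,y,z\in X$: $d(x,y)\ge 0$ and $d(x,x)=0$; $d(x,y)=0=d(y,x)$ implies $x=y$; and $d(x,y)\le d(x,z)+d(z,y)$ (symmetry is not required). Put $B^+(x,\epsilon)=\{y\in X:d(x,y)<\epsilon\}$; the forward topology $\tau(d)$ is the topology generated by these balls. A quasi-metric space $(X,d)$ is $T_1$ if $\tau(d)$ is $T_1$ (equivalently, $d(x,y)>0$ whenever $x\ne y$). A sequence $(x_n)$ is forward convergent to $x$ if $\lim_n d(x,x_n)=0$, and backward convergent to $x$ if $\lim_n d(x_n,x)=0$. The property ''forward convergence implies backward convergence'' means: whenever a sequence is forward convergent to a point, it is backward convergent to that point. A sequence $(x_n)$ is left K-Cauchy if for every $\epsilon>0$ there is $n_0\in\mathbb{N}$ such that $d(x_k,x_n)<\epsilon$ whenever $n_0\le k\le n$. $(X,d)$ is left K-complete if every left K-Cauchy sequence is forward convergent to some point of $X$. A map $f:(X,d)\to(Y,\rho)$ is left K-Cauchy regular if it maps every left K-Cauchy sequence in $(X,d)$ to a left K-Cauchy sequence in $(Y,\rho)$. It is ff-continuous if for every $x\in X$ and $\epsilon>0$ there is $\delta>0$ such that $d(x,y)<\delta$ implies $\rho(f(x),f(y))<\epsilon$. *)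

(* Defs.v *)
From HB Require Import structures.
From mathcomp Require Import all_boot all_order all_algebra.
From mathcomp Require Import all_classical all_reals all_analysis.

Set Implicit Arguments.
Unset Strict Implicit.
Unset Printing Implicit Defensive.

Import Order.TTheory GRing.Theory Num.Theory numFieldNormedType.Exports.

Local Open Scope classical_set_scope.
Local Open Scope ring_scope.

Record quasi_metric (R : realType) (X : Type) := QuasiMetric {
  qdist :> X -> X -> R;
  qdist_ge0 : forall x y, 0 <= qdist x y;
  qdistxx : forall x, qdist x x = 0;
  qdist_eq0 : forall x y, qdist x y = 0 -> qdist y x = 0 -> x = y;
  qdist_triangle : forall x y z, qdist x y <= qdist x z + qdist z y
}.

Definition forward_ball (R : realType) (X : Type) (d : quasi_metric R X)
    (x : X) (e : R) : set X :=
  [set y | d x y < e].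

(* The carrier X, tagged with d so that it can carry the topology tau(d). *)
Definition forward_space (R : realType) (X : Type) (d : quasi_metric R X) :
  Type := X.

HB.instance Definition _ (R : realType) (X : Type) (d : quasi_metric R X) :=
  Choice.copy (forward_space d) {classic X}.

Definition forward_balls (R : realType) (X : Type) (d : quasi_metric R X) :
    set (set X) :=
  [set B | exists x e, 0 < e /\ B = forward_ball d x e].

(* The subbase is indexed by its own members: the index type must be pointed,
   which X, possibly empty, need not be. *)
HB.instance Definition _ (R : realType) (X : Type) (d : quasi_metric R X) :=
  isSubBaseTopological.Build (forward_space d) (forward_balls d) id.

Definition T1_quasi_metric (R : realType) (X : Type) (d : quasi_metric R X) :=
  accessible_space (forward_space d).

Definition forward_cvg (R : realType) (X : Type) (d : quasi_metric R X)
    (u : nat -> X) (x : X) :=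
  d x (u n) @[n --> \oo] --> (0 : R).

Definition backward_cvg (R : realType) (X : Type) (d : quasi_metric R X)
    (u : nat -> X) (x : X) :=
  d (u n) x @[n --> \oo] --> (0 : R).

Definition forward_cvg_implies_backward_cvg (R : realType) (X : Type)
    (d : quasi_metric R X) :=
  forall (u : nat -> X) (x : X), forward_cvg d u x -> backward_cvg d u x.

Definition left_K_cauchy (R : realType) (X : Type) (d : quasi_metric R X)
    (u : nat -> X) :=
  forall e : R, 0 < e -> exists n0 : nat, forall k n : nat,
    (n0 <= k)%N -> (k <= n)%N -> d (u k) (u n) < e.

Definition left_K_complete (R : realType) (X : Type) (d : quasi_metric R X) :=
  forall u : nat -> X, left_K_cauchy d u -> exists x : X, forward_cvg d u x.

Definition left_K_cauchy_regular (R : realType) (X Y : Type)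
    (d : quasi_metric R X) (rho : quasi_metric R Y) (f : X -> Y) :=
  forall u : nat -> X, left_K_cauchy d u -> left_K_cauchy rho (f \o u).

Definition ff_continuous (R : realType) (X Y : Type)
    (d : quasi_metric R X) (rho : quasi_metric R Y) (f : X -> Y) :=
  forall (x : X) (e : R), 0 < e -> exists2 delta : R, 0 < delta &
    forall y : X, d x y < delta -> rho (f x) (f y) < e.

(* Main.v *)
(* A left K-Cauchy sequence u converges forward to some x, hence f \o u converges
   forward, and so also backward, to f x; a sequence converging both ways to a
   point y is left K-Cauchy, by going through y in the triangle inequality. *)
Require Import Defs.
From mathcomp Require Import all_boot all_order all_algebra.
From mathcomp Require Import all_classical all_reals all_analysis.

Import Order.TTheory GRing.Theory Num.Theory numFieldNormedType.Exports.

Local Open Scope classical_set_scope.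
Local Open Scope ring_scope.

(** Nonnegativity removes the norm from [cvgr0Pnorm_lt], so that distances are compared with [e]
    directly. *)
Lemma ge0_cvg0P (R : realType) (v : nat -> R) (v_ge0 : forall n, 0 <= v n) :
  v n @[n --> \oo] --> (0 : R) <->
  forall e, 0 < e -> \forall n \near \oo, v n < e.
Proof.
split=> [/cvgr0Pnorm_lt v0 e /v0|v0].
  by apply: filterS => n; rewrite ger0_norm.
apply/cvgr0Pnorm_lt => e /v0.
by apply: filterS => n; rewrite ger0_norm.
Qed.

Lemma ff_continuous_forward_cvg (R : realType) (X Y : Type)
    (d : quasi_metric R X) (rho : quasi_metric R Y) (f : X -> Y)
    (u : nat -> X) (x : X) :
  ff_continuous d rho f -> forward_cvg d u x ->
  forward_cvg rho (f \o u) (f x).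
Proof.
move=> f_cont /ge0_cvg0P u_x.
apply/ge0_cvg0P => [n|e /(f_cont x)[delta delta0 f_delta]].
  exact: qdist_ge0.
(* Used as a view, [ge0_cvg0P] leaves its premise [v_ge0] as the first argument of [u_x]. *)
have := u_x (fun n => qdist_ge0 d x (u n)) delta delta0.
by apply: filterS => n; apply: f_delta.
Qed.

Lemma forward_backward_cvg_left_K_cauchy (R : realType) (X : Type)
    (d : quasi_metric R X) (u : nat -> X) (x : X) :
  forward_cvg d u x -> backward_cvg d u x -> left_K_cauchy d u.
Proof.
move=> /ge0_cvg0P fwd /ge0_cvg0P bwd e e0.
have e20 : 0 < e / 2 by rewrite divr_gt0.
(* A single rank [N] beyond which both [d x (u n)] and [d (u n) x] are below [e / 2]. *)
have [N _ HN] := filterI (fwd (fun n => qdist_ge0 d x (u n)) _ e20)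
                         (bwd (fun n => qdist_ge0 d (u n) x) _ e20).
exists N => k n Nk kn; rewrite [e]splitr.
(* Backward convergence bounds the leg [d (u k) x], forward convergence the leg [d x (u n)]. *)
apply: le_lt_trans (qdist_triangle d _ _ x) _; apply: ltrD.
- by have [] := HN k Nk.
- by have [] := HN n (leq_trans Nk kn).
Qed.

Theorem theorem4p3 (R : realType) (X Y : Type)
    (d : quasi_metric R X) (rho : quasi_metric R Y)
    (X_complete : left_K_complete d)
    (Y_T1 : T1_quasi_metric rho)
    (Y_fwd_bwd : forward_cvg_implies_backward_cvg rho)
    (f : X -> Y) (f_cont : ff_continuous d rho f) :
  left_K_cauchy_regular d rho f.
Proof.
move=> u /X_complete[x u_x].
have fu_fx : forward_cvg rho (f \o u) (f x).
  exact: ff_continuous_forward_cvg f_cont u_x.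
exact: forward_backward_cvg_left_K_cauchy fu_fx (Y_fwd_bwd _ _ fu_fx).
Qed.
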